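(* Consider the plant $\dot{x}(t)=A(y(t))x(t)+\beta(y(t),u(t))+\delta(t)$, $y(t)=Cx(t)$, together with disturbance bounds $\underline{\delta},\overline{\delta}$, an integer $\phi\ge 1$, $\mathbf{K}=\{1,\ldots,\phi\}$, $\mathbf{I}=\{1,\ldots,n\}$, gain matrices $\overline{L}_k,\underline{L}_k\in\mathbb{R}^{n\times p}$ ($k\in\mathbf{K}$), and the observer $$\dot{\overline{x}}=A(y)\overline{x}+\overline{Q}(\overline{x},y)+\beta(y,u)+\overline{\delta},\qquad \dot{\underline{x}}=A(y)\underline{x}+\underline{Q}(\underline{x},y)+\beta(y,u)+\underline{\delta},$$ where, for $i\in\mathbf{I}$, $$\overline{Q}_i(\overline{x},y)=\min_{k\in\mathbf{K}}[\overline{L}_k]_i(C\overline{x}-y),\qquad \underline{Q}_i(\underline{x},y)=\max_{k\in\mathbf{K}}[\underline{L}_k]_i(C\underline{x}-y),$$ all as specified in the context. Suppose that for each $k\in\mathbf{K}$, the matrices $A(\omega)+\overline{L}_kC$ and $A(\omega)+\underline{L}_kC$ are Metzler for all $\omega\in\mathbb{R}^p$. Assume that there exist integers $\overline{l},\underline{l}\in\mathbf{K}$, real vectors $\overline{v}=[\overline{v}_1,\ldots,\overline{v}_n]^T\gg 0$, $\underline{v}=[\underline{v}_1,\ldots,\underline{v}_n]^T\gg 0$ and real scalars $\overline{\epsilon},\underline{\epsilon}>0$ such that $$\forall i\in\mathbf{I}\ \ \forall\omega\in\mathbb{R}^p\quad [A(\omega)+\overline{L}_{\overline{l}}C]_i\,\overline{v}\le-\overline{\epsilon}\,\overline{v}_i,$$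 $$\forall i\in\mathbf{I}\ \ \forall\omega\in\mathbb{R}^p\quad [A(\omega)+\underline{L}_{\underline{l}}C]_i\,\underline{v}\le-\underline{\epsilon}\,\underline{v}_i.$$ Then for any $u\in\mathcal{U}$ and any $x_0\in\mathbb{R}^n$ satisfying $\underline{x}(0)\le x_0\le\overline{x}(0)$, the following hold, where $x$ is the plant solution with $x(0)=x_0$ and $(\overline{x},\underline{x})$ is the observer solution: (i) If $\delta(t)\equiv\overline{\delta}(t)\equiv\underline{\delta}(t)\equiv 0$, then $$T_{x_0,u,\delta}=\infty\ \Rightarrow\ \lim_{t\to\infty}|\overline{x}(t)-x(t)|=0\ \text{ and }\ \lim_{t\to\infty}|\underline{x}(t)-x(t)|=0.$$ (ii) If $\delta\in\mathcal{D}$ satisfies $\underline{\delta}(t)\le\delta(t)\le\overline{\delta}(t)$ for almost all $t\in\mathbb{R}_+$, then $$\underline{x}(t)\le x(t)\le\overline{x}(t),\quad\forall t\in[0,T_{x_0,u,\delta}).$$ (iii) If $\delta\in\mathcal{D}$ satisfies $\underline{\delta}(t)\le\delta(t)\le\overline{\delta}(t)$ for almost all $t\in\mathbb{R}_+$, and $T_{x_0,u,\delta}=\infty$, then $$\limsup_{t\to\infty}\max_{i\in\mathbf{I}}\frac{1}{\overline{v}_i}(\overline{x}_i(t)-x_i(t))\le\frac{n}{\overline{\epsilon}}\limsup_{t\to\infty}\max_{i\in\mathbf{I}}\frac{\overline{\delta}_i(t)-\delta_i(t)}{\overline{v}_i},$$ $$\limsup_{t\to\infty}\max_{i\in\ma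thbf{I}}\frac{1}{\underline{v}_i}(x_i(t)-\underline{x}_i(t))\le\frac{n}{\underline{\epsilon}}\limsup_{t\to\infty}\max_{i\in\mathbf{I}}\frac{\delta_i(t)-\underline{\delta}_i(t)}{\underline{v}_i}.$$
   Context: Notation: $\mathbb{R}_+=[0,\infty)$; $|v|$ is the Euclidean norm on $\mathbb{R}^n$. For $x,y\in\mathbb{R}^n$, $x\le y$ means $y-x\in\mathbb{R}_+^n$ (componentwise inequality), and $x\ll y$ means that $y-x$ lies in the interior of $\mathbb{R}_+^n$ (strict inequality in every component). A square real matrix is Metzler if each of its off-diagonal entries is nonnegative. For a matrix $M$, $[M]_i$ denotes its $i$-th row; for a vector, a subscript $i$ denotes the $i$-th component. Plant: $x(t)\in\mathbb{R}^n$ is the state, $y(t)\in\mathbb{R}^p$ the output, $x(0)=x_0$ the initial condition. The matrix $C\in\mathbb{R}^{p\times n}$ is constant; $A:\mathbb{R}^p\to\mathbb{R}^{n\times n}$ and $\beta:\mathbb{R}^p\times\mathbb{R}^q\to\mathbb{R}^n$ are locally Lipschitz. The input $u:\mathbb{R}_+\to\mathbb{R}^q$ belongs to the set $\mathcal{U}$ of piecewise continuous functions. The disturbance $\delta:\mathbb{R}_+\to\mathbb{R}^n$ belongs to the set $\mathcal{D}$ of Lebesgue measurable locally essentially bounded functions. $[0,T_{x_0,u,\delta})$ denotes the maximal interval in $\mathbb{R}_+$ on which the unique plant solution $x(t)$ exists ($T_{x_0,u,\delta}\in(0,\infty]$ is the escape time for the given $x_0,u,\delta$). Disturbance bounds: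 $\underline{\delta},\overline{\delta}:\mathbb{R}_+\to\mathbb{R}^n$ are known piecewise continuous functions satisfying $\underline{\delta}(t)\le\delta(t)\le\overline{\delta}(t)$ for almost all $t\in\mathbb{R}_+$. Observer: $\overline{Q}=[\overline{Q}_1,\ldots,\overline{Q}_n]^T$ and $\underline{Q}=[\underline{Q}_1,\ldots,\underline{Q}_n]^T$ are vector-valued functions with the components given in the claim. The observer is driven by the plant output $y(t)=Cx(t)$ and the input $u(t)$, and has states $\overline{x}(t),\underline{x}(t)\in\mathbb{R}^n$ with initial values $\overline{x}(0),\underline{x}(0)$. Solutions of the plant and observer differential equations are understood in the almost-everywhere (Carathéodory) sense. *)

(* Defs.v *)
(* R^n is represented by the column vectors 'cV[R]_n, over R : realType. *)
From HB Require Import structures.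
From mathcomp Require Export all_boot all_order all_algebra.
From mathcomp Require Export all_classical all_reals all_analysis.
Export Order.TTheory GRing.Theory Num.Theory.
Export numFieldNormedType.Exports.

Set Implicit Arguments.
Unset Strict Implicit.
Unset Printing Implicit Defensive.

Local Open Scope classical_set_scope.
Local Open Scope ring_scope.

Section Vectors.
Context {R : realType}.

(* The library norm `|v| on matrices is the sup norm. *)
Definition enorm n (v : 'cV[R]_n) : R := Num.sqrt (\sum_i v i 0 ^+ 2).

Definition cvec_le n (v w : 'cV[R]_n) : Prop := forall i, v i 0 <= w i 0.

Definition cvec_ll n (v w : 'cV[R]_n) : Prop := forall i, v i 0 < w i 0.

Definition metzler n (M : 'M[R]_n) : Prop := forall i j, i != j -> 0 <= M i j.

End Vectors.

Section Functions.
Context {R : realType}.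

Definition locally_lipschitz (V W : normedModType R) (f : V -> W) : Prop :=
  forall z : V, exists2 U, nbhs z U & [lipschitz f y | y in U].

(* A function on R_+ is represented by a function on R whose values at negative
   arguments are irrelevant.  The one-sided limits are limits in V, so finite. *)
Definition piecewise_continuous (V : normedModType R) (f : R -> V) : Prop :=
  [/\ (forall b, finite_set [set t | 0 < t < b /\ ~ {for t, continuous f}]),
      (forall t, 0 <= t -> cvg (f s @[s --> t^'+]))
    & (forall t, 0 < t -> cvg (f s @[s --> t^'-]))].

(* The domain carries the Lebesgue (Caratheodory) sigma-algebra, which is
   strictly finer than the canonical Borel one on R. *)
Definition lebesgue_measurable_fun (D : set R) (f : R -> R) : Prop :=
  measurable_fun (T := caratheodory_type ((@wlength R idfun)^*)%mu)
    (U := R) D f.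

Definition locally_ess_bounded n (d : R -> 'cV[R]_n) : Prop :=
  forall b : R, exists M : R,
    {ae lebesgue_measure, forall t, t \in `[0, b] -> enorm (d t) <= M}.

Definition disturbance n (d : R -> 'cV[R]_n) : Prop :=
  (forall i, lebesgue_measurable_fun `[0, +oo[%classic (fun t => d t i 0)) /\
  locally_ess_bounded d.

Definition absolutely_continuous (V : normedModType R) (a b : R) (f : R -> V) :
    Prop :=
  forall e, 0 < e -> exists2 r, 0 < r &
    forall (m : nat) (c d : 'I_m -> R),
      (forall j, [/\ a <= c j, c j <= d j & d j <= b]) ->
      trivIset setT (fun j => `]c j, d j[%classic) ->
      \sum_j (d j - c j) < r ->
      \sum_j `|f (d j) - f (c j)| < e.

(* x solves x' = f(t, x) on [0, T[ in the sense of Caratheodory. *)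
Definition caratheodory_sol n (f : R -> 'cV[R]_n -> 'cV[R]_n) (T : \bar R)
    (x : R -> 'cV[R]_n) : Prop :=
  (forall b : R, 0 <= b -> (b%:E < T)%E -> absolutely_continuous 0 b x) /\
  {ae lebesgue_measure, forall t : R,
     0 < t -> (t%:E < T)%E -> is_derive t 1 x (f t (x t))}.

(* [0, T[ is the maximal interval of existence, T <= +oo the escape time: no
   solution on a strictly longer interval extends x. *)
Definition maximal_sol n (f : R -> 'cV[R]_n -> 'cV[R]_n) (x0 : 'cV[R]_n)
    (T : \bar R) (x : R -> 'cV[R]_n) : Prop :=
  [/\ (0 < T)%E, x 0 = x0, caratheodory_sol f T x &
      forall (T' : \bar R) (x' : R -> 'cV[R]_n), (T < T')%E ->
        caratheodory_sol f T' x' ->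
        ~ (forall t : R, 0 <= t -> (t%:E < T)%E -> x' t = x t)].

End Functions.

Section Observer.
Context {R : realType} (n p q : nat).
Context (A : 'cV[R]_p -> 'M[R]_n) (beta : 'cV[R]_p * 'cV[R]_q -> 'cV[R]_n).
Context (C : 'M[R]_(p, n)).

Definition plant_rhs (u : R -> 'cV[R]_q) (delta : R -> 'cV[R]_n)
    (t : R) (xi : 'cV[R]_n) : 'cV[R]_n :=
  A (C *m xi) *m xi + beta (C *m xi, u t) + delta t.

(* The index set K has phi.+1 >= 1 elements.  As min and max are idempotent,
   the initial value taken from the family itself does not change the result. *)
Definition Qmin phi (L : 'I_phi.+1 -> 'M[R]_(n, p)) (xi : 'cV[R]_n)
    (y : 'cV[R]_p) : 'cV[R]_n :=
  let F i k := (row i (L k) *m (C *m xi - y)) 0 0 in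
  \col_i \big[Num.min/F i ord0]_(k < phi.+1) F i k.

Definition Qmax phi (L : 'I_phi.+1 -> 'M[R]_(n, p)) (xi : 'cV[R]_n)
    (y : 'cV[R]_p) : 'cV[R]_n :=
  let F i k := (row i (L k) *m (C *m xi - y)) 0 0 in
  \col_i \big[Num.max/F i ord0]_(k < phi.+1) F i k.

(* Q is Qmin L or Qmax L, d the corresponding disturbance bound. *)
Definition observer_rhs (Q : 'cV[R]_n -> 'cV[R]_p -> 'cV[R]_n)
    (y : R -> 'cV[R]_p) (u : R -> 'cV[R]_q) (d : R -> 'cV[R]_n)
    (t : R) (xi : 'cV[R]_n) : 'cV[R]_n :=
  A (y t) *m xi + Q xi (y t) + beta (y t, u t) + d t.

End Observer.

(* limsup_{t -> +oo} max_i g_i(t), in the extended reals; max over the empty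
   index set is -oo, so for n > 0 this is the genuine maximum. *)
Definition limsup_max {R : realType} n (g : R -> 'I_n -> R) : \bar R :=
  limf_esup (fun t => \big[maxe/-oo%E]_(i < n) (g t i)%:E) (+oo%R : set_system R).

(* Main.v *)
(* The errors e = xbar - x and e = x - xund both satisfy, for almost every t,
   e_i' = min_k [M_k(t) e]_i + w_i with M_k(t) = A(y(t)) + L_k C Metzler and
   w >= 0. At an index i where e_j / v_j is maximal the Metzler property gives
   [M_k e]_i <= (e_i / v_i) [M_k v]_i. For -e and v = (1, ..., 1) this is a linear
   growth bound, so max_i (-e_i) stays below eta exp(2Kt) for each eta > 0 and
   e >= 0. For the distinguished k and v it gives V' <= -eps V + max_i w_i / v_i
   for V = max_i e_i / v_i, so V is eventually below c / eps + eta as soon as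
   w_i <= c v_i eventually; this is stronger than the claim by the factor n. The
   comparisons hold for absolutely continuous functions because such a function
   with nonpositive right Dini derivative almost everywhere cannot increase. *)
Require Import Defs.
From mathcomp Require Import ring lra.

Set Implicit Arguments.
Unset Strict Implicit.
Unset Printing Implicit Defensive.

Local Open Scope classical_set_scope.
Local Open Scope ring_scope.

(** * Absolute continuity and monotonicity from right Dini derivatives *)

Lemma ac_continuous_at (R : realType) (V : normedModType R) (a b : R)
    (f : R -> V) (t e : R) :
  absolutely_continuous a b f -> a <= t <= b -> 0 < e ->
  exists2 r, 0 < r &
    forall s, a <= s <= b -> `|s - t| < r -> `|f s - f t| < e.
Proof.
move=> acf /andP[at_ tb] e0; have [r r0 fr] := acf e e0; exists r => //.
have close c d : a <= c -> c <= d -> d <= b -> d - c < r ->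
    `|f d - f c| < e.
  move=> ac cd db dcr.
  have := fr 1 (fun=> c) (fun=> d); rewrite !big_ord1; apply => //.
  by move=> i j _ _ _; rewrite !ord1.
move=> s /andP[as_ sb]; have [ts|st] := leP t s.
- by rewrite ger0_norm ?subr_ge0//; exact: close.
- by rewrite ltr0_norm ?subr_lt0// opprB distrC; apply: close => //; exact: ltW.
Qed.

(** Outer regularity, applied to a measurable null set containing [N]. *)
Lemma negligible_open_cover (R : realType) (N : set R) (r : R) :
  lebesgue_measure.-negligible N -> 0 < r ->
  exists U : set R,
    [/\ open U, N `<=` U & (lebesgue_measure U <= r%:E)%E].
Proof.
move=> [D [mD muD ND]] r0.
have [|U [oU DU UD]] := lebesgue_regularity_outer mD _ r0.
  by rewrite [ltLHS]muD.
exists U; split => //; first exact: subset_trans ND DU.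
have mU := measurable_realfun.open_measurable oU.
rewrite (measureDI lebesgue_measure mU mD) (setIidr DU).
rewrite [X in (_ + X)%E]muD adde0.
exact: ltW.
Qed.

(** Turns the measure bound on [U] into the bound on total length that the definition of absolute
    continuity asks for. *)
Lemma sum_length_le (R : realType) (U : set R) (m : nat) (c d : 'I_m -> R) :
  open U -> (forall j, c j <= d j) -> (forall j, `]c j, d j[ `<=` U) ->
  trivIset setT (fun j => `]c j, d j[%classic) ->
  ((\sum_j (d j - c j))%:E <= lebesgue_measure U)%E.
Proof.
move=> oU cd cdU tI.
have -> : (\sum_j (d j - c j))%:E =
    (\sum_(j < m) lebesgue_measure `]c j, d j[%classic)%E :> \bar R.
  rewrite -sumEFin; apply: eq_bigr => j _.
  rewrite lebesgue_measure_itv/= lte_fin; case: ltP => // dc.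
  by congr EFin; apply/eqP; rewrite subr_eq0 eq_le dc cd.
rewrite -measure_bigsetU_ord//; apply: le_measure.
- by rewrite inE; apply: bigsetU_measurable => j _; exact: measurable_itv.
- by rewrite inE; exact: measurable_realfun.open_measurable.
- by apply: (big_ind (fun A => A `<=` U)) => // A B AU BU x [/AU|/BU].
Qed.

(* Real induction along [a, b]: at a point where the slope bound holds one steps
   by it, and at any other point one steps inside a small open cover U of the
   exceptional null set, where absolute continuity bounds the total variation
   collected. The slack h in S makes S closed under suprema. *)
Lemma ac_right_dini_le (R : realType) (a b : R) (f : R -> R) :
  a <= b -> absolutely_continuous a b f ->
  {ae lebesgue_measure, forall t, a < t < b -> forall e, 0 < e ->
     \forall s \near t^'+, f s - f t <= e * (s - t)} ->
  f b <= f a.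
Proof.
move=> ab acf dini; apply/ler_addgt0Pr => e0 e0_gt0.
(* The budget [e0] is split three ways: one [e] for the variation inside [U], one for the slack [h],
   and [e * (b - a)] for the slope bound. *)
pose e := e0 / (1 + 1 + (b - a)).
have den_gt0 : 0 < 1 + 1 + (b - a) by lra.
have e_gt0 : 0 < e by exact: divr_gt0.
have [r r0 fr] := acf e e_gt0.
pose P t := a < t < b -> forall e, 0 < e ->
  \forall s \near t^'+, f s - f t <= e * (s - t).
have r20 : 0 < r / 2 by lra.
(* The point [a] joins the exceptional set because [P a] holds vacuously. Measure at most [r / 2]
   keeps total lengths strictly below [r]. *)
have [|U [oU NU Ur]] :=
    @negligible_open_cover _ (~` [set t | P t] `|` [set a]) _ _ r20.
  apply: negligibleU; first exact: dini.
  by apply/negligibleP; [exact: measurable_set1 | exact: lebesgue_measure_set1].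
pose S := [set s | a <= s <= b /\ forall h, 0 < h ->
  exists m (c d : nat -> R), [/\
    (forall j, (j < m)%N -> [/\ a <= c j, c j <= d j, d j <= s &
       `]c j, d j[ `<=` U]),
    (forall i j, (i < j < m)%N -> d i <= c j) &
    f s - f a <= e * (s - a) + \sum_(j < m) `|f (d j) - f (c j)| + h]].
suff [_ /(_ _ e_gt0)[m [c [d [cdP cd_sep fba]]]]] : S b.
  have cdI : trivIset setT (fun j : 'I_m => `]c j, d j[%classic).
    move=> i j _ _ [z []]; rewrite /= !in_itv/= => /andP[? ?] /andP[? ?].
    apply/val_inj/eqP; case: ltngtP => // ij.
    - have := cd_sep i j; rewrite ij ltn_ord => /(_ erefl) ?; lra.
    - have := cd_sep j i; rewrite ij ltn_ord => /(_ erefl) ?; lra.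
  have : \sum_(j < m) `|f (d j) - f (c j)| < e.
    apply: fr.
    - by move=> j; have [] := cdP _ (ltn_ord j).
    - exact: cdI.
    - have := @sum_length_le _ U m (fun j => c j) (fun j => d j) oU.
      move=> /(_ _ _ _)/le_trans => /(_ _ _ _ _ Ur); rewrite lee_fin => dcr.
      apply: le_lt_trans (dcr _ _ _) _; last by lra.
      + by move=> j; have [] := cdP _ (ltn_ord j).
      + by move=> j; have [] := cdP _ (ltn_ord j).
      + exact: cdI.
  have : e * (1 + 1 + (b - a)) = e0 by rewrite mulfVK// gt_eqF.
  by rewrite !mulrDr mulr1 => ? ?; lra.
have Sa : S a.
  split; first by rewrite lexx.
  move=> h h0; exists 0%N, (fun=> a), (fun=> a); split => //.
  by rewrite big_ord0 !subrr mulr0 !add0r ltW.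
have ubS : ubound S b by move=> s [/andP[]].
have supS : has_sup S by split; [exists a | exists b].
set t := sup S.
have at_ : a <= t by apply: ub_le_sup => //; exists b.
have tb : t <= b by apply: ge_sup => //; exists a.
have St : S t.
  split; first exact/andP.
  (* Half of the slack goes to a point [s] of [S] close to [t], the other half to the continuity of
     [f] at [t]. *)
  move=> h h0; have h20 : 0 < h / 2 by lra.
  have tab : a <= t <= b by exact/andP.
  have [r' r'0 ft] := ac_continuous_at acf tab h20.
  have [s Ss] := sup_adherent r'0 supS; rewrite -/t => trs.
  have st : s <= t by apply: ub_le_sup => //; exists b.
  have [/andP[as_ sb] /(_ _ h20)[m [c [d [cdP cd_sep fsa]]]]] := Ss.
  exists m, c, d; split => //.
    by move=> j /cdP[? ? ? ?]; split => //; exact: le_trans st.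
  have : `|f s - f t| < h / 2.
    apply: ft; first exact/andP.
    by rewrite ler0_norm ?subr_le0//; lra.
  rewrite distrC => /(le_lt_trans (ler_norm _)).
  have := ler_wpM2l (ltW e_gt0) (lerB st (lexx a)).
  by move=> ? ?; lra.
have [tltb|//|<-//] := ltgtP t b; last by rewrite ltNge tb.
exfalso.
suff [s ts Ss] : exists2 s, t < s & S s.
  have : s <= t by apply: ub_le_sup => //; exists b.
  by rewrite leNgt ts.
have [_ tS] := St.
have [Ut|nUt] := pselect (U t).
(* Inside the cover, the interval from [t] to [s] is appended to the family and pays for the whole
   increment of [f]. *)
- have /nbhs_ballP[r' /= r'0 rU] : nbhs t U by exact: open_nbhs_nbhs.
  pose s := Num.min (t + r' / 2) b.
  have ts : t < s by rewrite lt_min tltb andbT; lra.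
  have sb : s <= b by rewrite ge_min lexx orbT.
  have str : s <= t + r' / 2 by rewrite ge_min lexx.
  exists s => //; split; first by apply/andP; split=> //; lra.
  move=> h h0; have [m [c [d [cdP cd_sep fta]]]] := tS _ h0.
  exists m.+1, (fun j => if (j < m)%N then c j else t),
    (fun j => if (j < m)%N then d j else s); split.
  + move=> j _; case: ifPn => [/cdP[? ? ? ?]|_]; split => //; try lra.
    move=> z; rewrite /= in_itv/= => /andP[? ?]; apply: rU.
    by rewrite /ball/= ltr0_norm; lra.
  + move=> i j /andP[ij jm].
    have im : (i < m)%N by exact: leq_trans ij jm.
    rewrite im; case: ifPn => [jm'|_]; first by apply: cd_sep; rewrite ij.
    by have [] := cdP _ im.
  + rewrite big_ord_recr/= ltnn.
    under eq_bigr => i _ do rewrite ltn_ord.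
    have := ler_norm (f s - f t).
    have := ler_wpM2l (ltW e_gt0) (lerB (ltW ts) (lexx a)).
    by move=> ? ?; lra.
(* Outside the cover the Dini bound holds at [t], so the family is kept and the term [e * (s - a)]
   absorbs the increment. *)
- have nNt : ~ (~` [set t | P t] `|` [set a]) t by move/NU.
  have Pt : P t by apply: contrapT => nPt; apply: nNt; left.
  have ta : t <> a by move=> ta; apply: nNt; right.
  have atb : a < t < b.
    by rewrite tltb andbT lt_neqAle at_ andbT eq_sym; exact/eqP.
  have near_t : \forall s \near t^'+,
      [/\ f s - f t <= e * (s - t), t < s & s < b].
    near=> s; split.
    + by near: s; exact: Pt.
    + by near: s; exact: nbhs_right_gt.
    + by near: s; exact: nbhs_right_lt.
  have [s [fs ts sb]] := @filter_ex _ _ (at_right_proper_filter t) _ near_t.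
  exists s => //; split; first by apply/andP; split; lra.
  move=> h h0; have [m [c [d [cdP cd_sep fta]]]] := tS _ h0.
  exists m, c, d; split => //.
  + by move=> j /cdP[? ? ? ?]; split => //; lra.
  + by move: fs fta; rewrite !mulrBr; lra.
Unshelve. all: by end_near. Qed.

(** * Closure properties of absolute continuity, norm bounds and derivatives *)

Lemma absolutely_continuousB (R : realType) (V : normedModType R) (a b : R)
    (f g : R -> V) :
  absolutely_continuous a b f -> absolutely_continuous a b g ->
  absolutely_continuous a b (f \- g).
Proof.
move=> acf acg e e0; have e20 : 0 < e / 2 by lra.
have [r r0 fr] := acf _ e20; have [s s0 gs] := acg _ e20.
exists (Num.min r s) => [|m c d cd tI]; rewrite lt_min ?r0// => /andP[lr ls].
have := ltrD (fr _ _ _ cd tI lr) (gs _ _ _ cd tI ls).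
rewrite -splitr -big_split/=; apply: le_lt_trans; apply: ler_sum => j _.
apply: le_trans (ler_normB _ _); rewrite !opprB [g (c j) - _]addrC addrACA.
by rewrite [- g (d j) + _]addrC.
Qed.

Lemma absolutely_continuous_sub (R : realType) (V : normedModType R)
    (a b a' : R) (f : R -> V) :
  a <= a' -> absolutely_continuous a b f -> absolutely_continuous a' b f.
Proof.
move=> aa' acf e /acf[r r0 fr]; exists r => // m c d cd.
by apply: fr => j; have [? ? ?] := cd j; split => //; exact: le_trans aa' _.
Qed.

Lemma absolutely_continuous_dominated (R : realType) (V W : normedModType R)
    (a b K : R) (f : R -> V) (F : R -> W) :
  absolutely_continuous a b f -> 0 <= K ->
  (forall s t, a <= s -> s <= t -> t <= b ->
     `|F t - F s| <= K * (`|f t - f s| + (t - s))) ->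
  absolutely_continuous a b F.
Proof.
(* Variation of [f] and total length each stay below [e']; [K + 1] in place of [K] avoids division
   by zero. *)
move=> acf K0 FK e e0; pose e' := e / (2 * (K + 1)).
have K10 : 0 < 2 * (K + 1) by lra.
have e'0 : 0 < e' by exact: divr_gt0.
have [r r0 fr] := acf _ e'0.
exists (Num.min r e') => [|m c d cd tI]; rewrite lt_min ?r0// => /andP[lr le'].
have lf := fr _ _ _ cd tI lr.
apply: (@le_lt_trans _ _
  (K * (\sum_j `|f (d j) - f (c j)| + \sum_j (d j - c j)))).
  rewrite -big_split/= mulr_sumr; apply: ler_sum => j _.
  by have [? ? ?] := cd j; exact: FK.
have -> : e = (K + 1) * (e' + e') by rewrite /e'; field; lra.
apply: le_lt_trans (_ : K * (e' + e') < _); last by rewrite ltr_pM2r; lra.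
by apply: ler_wpM2l => //; lra.
Qed.

Lemma normr_entry_le (R : realType) (m n : nat) (M : 'M[R]_(m, n)) i j :
  `|M i j| <= `|M|.
Proof.
by rewrite [leRHS]/Num.Def.normr/= mx_normrE; exact: (le_bigmax _ _ (i, j)).
Qed.

Lemma normr_mx_le (R : realType) (m n : nat) (M : 'M[R]_(m, n)) (K : R) :
  0 <= K -> (forall i j, `|M i j| <= K) -> `|M| <= K.
Proof.
move=> K0 MK; rewrite [leLHS]/Num.Def.normr/= mx_normrE.
by apply: bigmax_le => // -[i j] _; exact: MK.
Qed.

(** For [x <= y] the difference is [expR y * (1 - expR (x - y))], and [1 + z <= expR z] bounds the
    second factor by [y - x]. *)
Lemma expR_dist_le (R : realType) (m x y : R) : x <= m -> y <= m ->
  `|expR x - expR y| <= expR m * `|x - y|.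
Proof.
wlog xy : x y / x <= y => [hw xm ym|_ ym].
  have [xy|/ltW yx] := leP x y; first exact: hw.
  by rewrite distrC (distrC x); exact: hw.
rewrite !ler0_norm ?subr_le0 ?ler_expR// !opprB.
apply: (@le_trans _ _ (expR y * (y - x))); last first.
  by rewrite ler_wpM2r ?subr_ge0 ?ler_expR.
have -> : expR x = expR y * expR (x - y) by rewrite -expRD addrC subrK.
have := ler_wpM2l (expR_ge0 y) (expR_ge1Dx (x - y)).
by rewrite !mulrDr !mulrN mulr1; lra.
Qed.

Lemma is_derive_right_slope (R : realType) (F : R -> R) (t d e : R) :
  is_derive t 1 F d -> 0 < e ->
  \forall s \near t^'+, F s - F t <= (d + e) * (s - t).
Proof.
move=> [dF Fd] e0.
have /cvgrPdist_lt/(_ _ e0) : h^-1 *: (F (h *: 1 + t) - F t) @[h --> 0^'] --> d.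
  by rewrite -Fd; exact: dF.
move=> /nbhs_ballP[r /= r0 Fr]; apply/nbhs_ballP; exists r => //= s str ts.
have st0 : 0 < s - t by rewrite subr_gt0.
have := Fr (s - t); rewrite /ball/= sub0r normrN distrC => /(_ str).
rewrite gt_eqF// => /(_ isT); rewrite /GRing.scale/= mulr1 subrK.
rewrite distrC => /(le_lt_trans (ler_norm _)).
by rewrite ltrBlDl mulrC ltr_pdivrMr// => /ltW.
Qed.

Lemma is_derive_cvg (R : realType) (F : R -> R) (t d : R) :
  is_derive t 1 F d -> F s @[s --> t] --> F t.
Proof.
by move=> [dF _]; apply/differentiable_continuous/derivable1_diffP.
Qed.

Lemma is_derive_entry (R : realType) (m n : nat) (f : R -> 'M[R]_(m, n))
    (t : R) (df : 'M[R]_(m, n)) i j :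
  is_derive t 1 f df -> is_derive t 1 (fun s => f s i j) (df i j).
Proof.
move=> [dvf <-]; have := dvf => /derivable_mxP/(_ i j) dvfij.
by rewrite derive_mx// mxE; exact: DeriveDef.
Qed.

Lemma is_derive_mx (R : realType) (m n : nat) (f : R -> 'M[R]_(m, n)) (t : R)
    (df : 'M[R]_(m, n)) :
  (forall i j, is_derive t 1 (fun s => f s i j) (df i j)) ->
  is_derive t 1 f df.
Proof.
move=> dfij; have dvf : derivable f t 1.
  by apply/derivable_mxP => i j; have [] := dfij i j.
apply: DeriveDef => //; rewrite derive_mx//; apply/matrixP => i j.
by rewrite mxE; have [] := dfij i j.
Qed.

(** * Exponential barriers and comparison *)

Section Barrier.
Context {R : realType} (a c eta k : R).

(** The solution of B' = k (B - c) with B(a) = c + eta. A nonnegative [k] serves the positivity of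
    the error, a negative [k] its decay towards [c]. *)
Definition barrier (t : R) : R := c + eta * expR (k * (t - a)).

Lemma barrier_start : barrier a = c + eta.
Proof. by rewrite /barrier subrr mulr0 expR0 mulr1. Qed.

Lemma is_derive_barrier (t : R) : is_derive t 1 barrier (k * (barrier t - c)).
Proof.
have dl : is_derive t 1 (fun s : R => k * (s - a)) k.
  have -> : (fun s : R => k * (s - a)) = (k \*: (id - cst a) : R -> R) by [].
  by apply: is_derive_eq; rewrite subr0 /GRing.scale/= mulr1.
have de : is_derive t 1 (fun s : R => expR (k * (s - a)))
    (k * expR (k * (t - a))).
  by rewrite mulrC; exact: is_derive1_comp (is_derive_expR _) dl.
have := is_deriveD (is_derive_cst c t 1) (is_deriveZ eta de).
rewrite add0r /barrier; set D := _ *: _.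
have -> // : D = k * (c + eta * expR (k * (t - a)) - c).
by rewrite /D/GRing.scale/=; ring.
Qed.

Lemma barrier_lipschitz b : exists2 K, 0 <= K &
  forall s t, a <= s -> s <= t -> t <= b ->
    `|barrier t - barrier s| <= K * (t - s).
Proof.
exists (`|eta| * (expR (`|k| * (b - a)) * `|k|)) => [|s t as_ st tb].
  by rewrite !mulr_ge0 ?expR_ge0.
have km z : a <= z -> z <= b -> k * (z - a) <= `|k| * (b - a).
  move=> az zb; apply: (@le_trans _ _ (`|k| * (z - a))).
    by rewrite ler_wpM2r ?subr_ge0 ?ler_norm.
  by rewrite ler_wpM2l// lerB.
have -> : barrier t - barrier s =
    eta * (expR (k * (t - a)) - expR (k * (s - a))) by rewrite /barrier; ring.
rewrite normrM -mulrA ler_wpM2l//.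
apply: le_trans (expR_dist_le (m := `|k| * (b - a)) _ _) _.
- by apply: km => //; exact: le_trans st.
- by apply: km => //; exact: le_trans tb.
rewrite -mulrBr opprB addrA subrK normrM mulrA.
by rewrite [`|t - s|]ger0_norm// subr_ge0.
Qed.

End Barrier.

(** Capping at [h] and taking a maximum are both nonexpansive for the sup norm; this transfers
    absolute continuity to the capped excess over a barrier. *)
Lemma ler_norm_bigmax_min (R : realType) (n : nat) (h K : R)
    (F G : 'I_n -> R) : 0 <= K -> (forall i, `|F i - G i| <= K) ->
  `|\big[Num.max/0]_i Num.min h (F i) - \big[Num.max/0]_i Num.min h (G i)|
    <= K.
Proof.
move=> K0.
have half (F' G' : 'I_n -> R) : (forall i, `|F' i - G' i| <= K) ->
    \big[Num.max/0]_i Num.min h (F' i) <=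
    \big[Num.max/0]_i Num.min h (G' i) + K.
  move=> FG; apply: bigmax_le => [|i _].
    by rewrite addr_ge0// bigmax_idl le_max lexx.
  have := le_bigmax 0 (fun i => Num.min h (G' i)) i.
  have /(le_trans (ler_norm _)) := FG i.
  by rewrite !minEle; case: ifP => ?; case: ifP => ? ? ?; lra.
move=> FG; rewrite ler_norml; apply/andP; split.
- have GF i : `|G i - F i| <= K by rewrite distrC.
  by have := half _ _ GF; lra.
- by have := half _ _ FG; lra.
Qed.

(* Capping at h makes the derivative hypothesis needed only in a strip of
   height h above the barrier. *)
Lemma max_le_barrier (R : realType) (n : nat) (g : R -> 'cV[R]_n)
    (a b c eta k h : R) :
  a <= b -> 0 < h -> absolutely_continuous a b g ->
  (forall i, g a i 0 <= barrier a c eta k a) ->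
  {ae lebesgue_measure, forall t, a < t < b ->
     exists2 dg, is_derive t 1 g dg &
     forall i, (forall j, g t j 0 <= g t i 0) ->
       barrier a c eta k t <= g t i 0 < barrier a c eta k t + h ->
       dg i 0 <= k * (barrier a c eta k t - c)} ->
  forall i, g b i 0 <= barrier a c eta k b.
Proof.
move=> ab h0 acg ga dg i; set B := barrier a c eta k in ga dg *.
(* The default value 0 makes [phi] the capped positive part of the largest excess. Since [h > 0],
   [phi b <= 0] forces every component below the barrier. *)
pose phi t := \big[Num.max/0]_i Num.min h (g t i 0 - B t).
have phia : phi a <= 0.
  by apply: bigmax_le => // j _; rewrite ge_min subr_le0 ga orbT.
suff phib : phi b <= phi a.
  have := le_bigmax 0 (fun i => Num.min h (g b i 0 - B b)) i.
  move=> /le_trans/(_ (le_trans phib phia)).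
  by rewrite ge_min leNgt h0/= subr_le0.
apply: ac_right_dini_le => //.
  have [K K0 BK] := barrier_lipschitz a c eta k b.
  apply: (absolutely_continuous_dominated (K := 1 + K) acg); first by lra.
  move=> s t as_ st tb.
  have st0 : 0 <= K * (t - s) by rewrite mulr_ge0// subr_ge0.
  have gst0 : 0 <= K * `|g t - g s| by rewrite mulr_ge0.
  apply: ler_norm_bigmax_min => [|j].
    by apply: mulr_ge0; [lra|rewrite addr_ge0// subr_ge0].
  have -> : g t j 0 - B t - (g s j 0 - B s) =
      (g t - g s) j 0 - (B t - B s) by rewrite !mxE; ring.
  apply: le_trans (ler_normB _ _) _.
  have := normr_entry_le (g t - g s) j 0; have := BK s t as_ st tb.
  by rewrite -/B mulrDl mul1r mulrDr; move: st0 gst0; lra.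
apply: filterS dg; first exact: (ae_filter_ringOfSetsType lebesgue_measure).
move=> t dgt /dgt[dgt' gdg' dgB] e e0.
pose G j s := g s j 0 - B s.
have dG j : is_derive t 1 (G j) (dgt' j 0 - k * (B t - c)).
  have := is_derive_entry j 0 gdg'.
  by move=> dgj; apply: is_deriveB; exact: is_derive_barrier.
have phi0 : 0 <= phi t by rewrite /phi bigmax_idl le_max lexx.
(* Where the cap is reached, [phi] cannot exceed its value at [t]. *)
have [hphi|phih] := leP h (phi t).
  near=> s.
  have ts : t < s by near: s; exact: nbhs_right_gt.
  have : phi s <= h.
    by apply: bigmax_le => [|j _]; [exact: ltW | rewrite ge_min lexx].
  have : 0 <= e * (s - t) by rewrite mulr_ge0 ?subr_ge0 ?ltW.
  by lra.
have Gphi j : G j t <= phi t.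
  have := le_bigmax 0 (fun i => Num.min h (g t i 0 - B t)) j.
  rewrite -/(phi t) -/(G j t) ge_min => /orP[|//]; lra.
(* An index below the maximum stays below by continuity. One that attains it has a maximal component
   of [g] lying in the strip, so the derivative hypothesis applies. *)
have slope j : \forall s \near t^'+, G j s <= phi t + e * (s - t).
  have [Gt|Gt] := eqVneq (G j t) (phi t); last first.
    have Glt : G j t < phi t by rewrite lt_neqAle Gt Gphi.
    near=> s.
    have ts : t < s by near: s; exact: nbhs_right_gt.
    have : G j s < phi t.
      near: s; apply: cvgr_lt Glt.
      exact/cvg_at_right_filter/(is_derive_cvg (dG j)).
    have : 0 <= e * (s - t) by rewrite mulr_ge0 ?subr_ge0 ?ltW.
    by lra.
  have dle : dgt' j 0 - k * (B t - c) <= 0.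
    rewrite subr_le0; apply: dgB => [l|].
      by have := Gphi l; rewrite -Gt /G; lra.
    by move: phi0 phih; rewrite -Gt /G; lra.
  near=> s.
  have ts : t < s by near: s; exact: nbhs_right_gt.
  have : G j s - G j t <= (dgt' j 0 - k * (B t - c) + e) * (s - t).
    by near: s; exact: is_derive_right_slope.
  have : (dgt' j 0 - k * (B t - c) + e) * (s - t) <= e * (s - t).
    by rewrite ler_wpM2r ?subr_ge0 ?(ltW ts)//; lra.
  by lra.
near=> s.
have ts : t < s by near: s; exact: nbhs_right_gt.
rewrite lerBlDl; apply: bigmax_le => [|j _].
  by rewrite addr_ge0// mulr_ge0 ?subr_ge0 ?ltW.
rewrite ge_min; apply/orP; right; rewrite -/(G j s).
have : forall j, G j s <= phi t + e * (s - t) by near: s; exact: filter_forall.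
exact.
Unshelve. all: by end_near. Qed.

(** * Positivity and decay for Metzler error dynamics *)

(** The vector r v - x is nonnegative and vanishes at [i], so row [i] of [M] meets it only through
    nonnegative off-diagonal entries. *)
Lemma metzler_mulmx_le (R : realType) (n : nat) (M : 'M[R]_n) (x v : 'cV[R]_n)
    (i : 'I_n) (r : R) :
  metzler M -> (forall j, x j 0 <= r * v j 0) -> x i 0 = r * v i 0 ->
  (M *m x) i 0 <= r * (M *m v) i 0.
Proof.
move=> hM xv xvi; rewrite !mxE mulr_sumr; apply: ler_sum => j _.
have [->|ji] := eqVneq j i; first by rewrite xvi mulrCA.
by rewrite mulrCA ler_wpM2l// hM// eq_sym.
Qed.

(* The error of an observer with correction min_k [L_k]_i (C e) obeys, in each
   component, the smallest of the linear vector fields M_k e + w. *)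
Definition error_solution (R : realType) (n phi : nat)
    (M : 'I_phi.+1 -> R -> 'M[R]_n) (w : R -> 'cV[R]_n) (T : \bar R)
    (e : R -> 'cV[R]_n) : Prop :=
  (forall b : R, 0 <= b -> (b%:E < T)%E -> absolutely_continuous 0 b e) /\
  {ae lebesgue_measure, forall t : R, 0 < t -> (t%:E < T)%E ->
     exists2 de, is_derive t 1 e de &
     forall i, (exists k, de i 0 = (M k t *m e t) i 0 + w t i 0) /\
               (forall k, de i 0 <= (M k t *m e t) i 0 + w t i 0)}.

Lemma error_solution_ge0 (R : realType) (n phi : nat)
    (M : 'I_phi.+1 -> R -> 'M[R]_n) (w : R -> 'cV[R]_n) (T : \bar R)
    (e : R -> 'cV[R]_n) :
  error_solution M w T e -> (forall k t, metzler (M k t)) ->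
  (forall b : R, 0 <= b -> (b%:E < T)%E -> exists K : R,
     forall k t i, 0 <= t <= b -> (M k t *m const_mx 1 : 'cV_n) i 0 <= K) ->
  {ae lebesgue_measure, forall t : R, 0 < t -> (t%:E < T)%E ->
     cvec_le 0 (w t)} ->
  cvec_le 0 (e 0) ->
  forall t : R, 0 <= t -> (t%:E < T)%E -> cvec_le 0 (e t).
Proof.
move=> [ace dee] hM bM w0 e0 b b0 bT i; rewrite mxE leNgt; apply/negP => ebi.
have [K KM] := bM b b0 bT.
(* This [eta] puts the barrier at time [b] at half of the supposed violation [- e b i 0], which
   contradicts the comparison. *)
pose k := 2 * `|K|; pose eta := - e b i 0 / (2 * expR (k * (b - 0))).
have den0 : 0 < 2 * expR (k * (b - 0)) by rewrite mulr_gt0// expR_gt0.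
have eta0 : 0 < eta by rewrite divr_gt0// oppr_gt0.
have k0 : 0 <= k by rewrite mulr_ge0.
suff : (- e b) i 0 <= barrier 0 0 eta k b.
  rewrite mxE /barrier add0r.
  have -> : eta * expR (k * (b - 0)) = - e b i 0 / 2.
    by rewrite /eta; field; rewrite gt_eqF// expR_gt0.
  by lra.
apply: (@max_le_barrier _ _ (fun t => - e t) 0 b 0 eta k eta) => //.
- apply: (absolutely_continuous_dominated (K := 1) (ace b b0 bT)) => //.
  move=> s t _ st _; rewrite -opprD normrN mul1r lerDl subr_ge0//.
- by move=> j; rewrite barrier_start mxE; have := e0 j; rewrite mxE; lra.
apply: filterS2 dee w0; first exact: (ae_filter_ringOfSetsType lebesgue_measure).
move=> t /[swap] wt /[swap] /andP[t0 tb].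
have tT : (t%:E < T)%E by apply: lt_trans bT; rewrite lte_fin.
move=> /(_ t0 tT)[de ede deM]; exists (- de); first exact: is_deriveN.
move=> j maxj /andP[]; rewrite !mxE => Bj jB.
(* The strip has height [eta], so inside it [- e t j 0] is at most twice the barrier; this is the
   factor 2 in [k]. *)
have Beta : eta <= barrier 0 0 eta k t.
  rewrite /barrier add0r ler_peMr ?(ltW eta0)// -expR0 ler_expR.
  by rewrite mulr_ge0// subr_ge0 ltW.
(* The index [l] attaining the minimum gives the exact derivative of the component. *)
have [[l ->] _] := deM j.
have wj := wt t0 tT j; rewrite mxE in wj.
have Me : (M l t *m - e t) j 0 <= - e t j 0 * (M l t *m const_mx 1 : 'cV_n) j 0.
  apply: metzler_mulmx_le => [|m|]; first exact: hM.
  - by have := maxj m; rewrite !mxE mulr1.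
  - by rewrite !mxE mulr1.
have MK : (M l t *m const_mx 1 : 'cV_n) j 0 <= `|K|.
  by apply: le_trans (KM l t j _) (ler_norm _); rewrite !ltW.
have ej0 : 0 <= - e t j 0 by lra.
have := ler_wpM2l ej0 MK.
have : - e t j 0 * `|K| <= 2 * barrier 0 0 eta k t * `|K|.
  by rewrite ler_wpM2r//; lra.
by move: Me; rewrite mulmxN mxE subr0 /k; lra.
Qed.

Lemma error_solution_decay (R : realType) (n phi : nat)
    (M : 'I_phi.+1 -> R -> 'M[R]_n) (w : R -> 'cV[R]_n) (e : R -> 'cV[R]_n)
    (l : 'I_phi.+1) (v : 'cV[R]_n) (eps c a : R) :
  error_solution M w +oo%E e -> (forall t, metzler (M l t)) ->
  (forall t : R, 0 <= t -> cvec_le 0 (e t)) ->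
  cvec_ll 0 v -> 0 < eps -> (forall i t, (M l t *m v) i 0 <= - eps * v i 0) ->
  0 <= c -> 0 <= a ->
  (forall t : R, a < t -> forall i, w t i 0 <= c * v i 0) ->
  forall eta, 0 < eta ->
  \forall t \near +oo, forall i, e t i 0 / v i 0 <= c / eps + eta.
Proof.
move=> [ace dee] hM e0 v0 eps0 Mv c0 a0 wc eta eta0.
have vi0 i : 0 < v i 0 by have := v0 i; rewrite mxE.
pose g t : 'cV_n := \col_i (e t i 0 / v i 0).
(* With [D] the sup norm of the scaled error at time [a], the barrier starts above every component
   and relaxes to [c / eps] at rate [eps]. *)
pose D := `|g a|; pose B := barrier a (c / eps) D (- eps).
have D0 : 0 <= D by exact: normr_ge0.
have ceps0 : 0 <= c / eps by rewrite divr_ge0// ltW.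
have gB b i : a <= b -> g b i 0 <= B b.
  move=> ab; pose K := `|\col_i (v i 0)^-1|.
  have K0 : 0 <= K by exact: normr_ge0.
  apply: (@max_le_barrier _ _ g a b _ _ _ 1) => //.
  - have acab : absolutely_continuous a b e.
      apply: (absolutely_continuous_sub a0); apply: ace; last exact: ltry.
      exact: le_trans ab.
    apply: (absolutely_continuous_dominated (K := K) acab) => // s t _ st _.
    have st0 : 0 <= t - s by rewrite subr_ge0.
    apply: normr_mx_le => [|i' j]; first by rewrite mulr_ge0// addr_ge0.
    rewrite ord1 !mxE -mulrBl mulrC normrM; apply: ler_pM => //.
      have := normr_entry_le (\col_i (v i 0)^-1) i' 0.
      by rewrite mxE.
    have := normr_entry_le (e t - e s) i' 0; rewrite !mxE => /le_trans; apply.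
    by rewrite lerDl.
  - move=> j; rewrite barrier_start.
    have := le_trans (ler_norm _) (normr_entry_le (g a) j 0).
    by rewrite -/D; lra.
  apply: filterS dee; first exact: (ae_filter_ringOfSetsType lebesgue_measure).
  move=> t /[swap] /andP[at_ tb].
  have t0 : 0 < t by exact: le_lt_trans at_.
  move=> /(_ t0 (ltry _))[de ede deM]; exists (\col_i (de i 0 / v i 0)).
    apply: is_derive_mx => j j'; rewrite ord1 mxE.
    have -> : (fun s => g s j 0) = (v j 0)^-1 \*: (fun s => e s j 0).
      by apply/funext => s; rewrite mxE mulrC.
    by rewrite mulrC; apply: is_deriveZ; exact: is_derive_entry.
  move=> j maxj /andP[Bj _]; set r := g t j 0 in Bj.
  have B0 : 0 <= B t by rewrite addr_ge0// mulr_ge0// expR_ge0.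
  have r0 : 0 <= r by exact: le_trans Bj.
  have eg m : e t m 0 = g t m 0 * v m 0.
    by rewrite mxE divfK// gt_eqF.
  have Me : (M l t *m e t) j 0 <= r * (M l t *m v) j 0.
    apply: metzler_mulmx_le => [|m|]; [exact: hM| |exact: eg].
    by rewrite eg ler_wpM2r ?(ltW (vi0 m)).
  (* The minimum over all gains is at most the term of the distinguished gain [l]. *)
  have [_ /(_ l) dej] := deM j.
  rewrite mxE ler_pdivrMr//.
  have := ler_wpM2l r0 (Mv j t).
  have := ler_wpM2l (ltW (vi0 j)) (ler_wpM2l (ltW eps0) Bj).
  have := wc t at_ j.
  have -> : - eps * (barrier a (c / eps) D (- eps) t - c / eps) * v j 0 =
      c * v j 0 - v j 0 * (eps * B t) by rewrite /B; field; rewrite gt_eqF.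
  by rewrite -/B; lra.
near=> t.
have ab : a <= t by near: t; apply: nbhs_pinfty_ge; exact: num_real.
move=> i; have := gB t i ab; rewrite mxE => /le_trans; apply.
rewrite /B /barrier lerD2l mulNr expRN ler_pdivrMr ?expR_gt0//.
(* The linear lower bound on the exponential gives an explicit time, [a + D / (eta * eps)], after
   which the transient is at most [eta]. *)
apply: (@le_trans _ _ (eta * (1 + eps * (t - a)))); last first.
  by rewrite ler_wpM2l ?expR_ge1Dx ?(ltW eta0).
have : a + D / (eta * eps) <= t.
  by near: t; apply: nbhs_pinfty_ge; exact: num_real.
have ee0 : 0 < eta * eps by exact: mulr_gt0.
by rewrite -lerBrDl ler_pdivrMr// mulrDr mulr1; lra.
Unshelve. all: by end_near. Qed.

(** * Boundedness along trajectories, and extrema of finite families *)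

Lemma locally_lipschitz_continuous (R : realType) (V W : normedModType R)
    (f : V -> W) :
  locally_lipschitz f -> continuous f.
Proof.
move=> lf z; have [U zU [m [_ mf]]] := lf z.
(* The Lipschitz bound holds for constants beyond the threshold [m]; this one is also positive, so
   it can be divided by. *)
pose k := Num.max (m + 1) 1.
have k0 : 0 < k by rewrite lt_max ltr01 orbT.
have km : m < k by rewrite lt_max ltrDl ltr01.
apply/cvgrPdist_lt => e e0; near=> y.
have yU : U y by near: y.
have := mf k km (z, y); rewrite /= => /(_ (conj (nbhs_singleton zU) yU)).
move=> /le_lt_trans; apply; rewrite mulrC -ltr_pdivlMr//.
by near: y; apply: cvgr_dist_lt; rewrite ?divr_gt0.
Unshelve. all: by end_near. Qed.

Lemma normr_mulmx_le (R : realType) (m n p : nat) (M : 'M[R]_(m, n))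
    (N : 'M[R]_(n, p)) :
  `|M *m N| <= n%:R * `|M| * `|N|.
Proof.
apply: normr_mx_le => [|i j]; first by rewrite !mulr_ge0.
rewrite mxE; apply: le_trans (ler_norm_sum _ _ _) _.
have -> : n%:R * `|M| * `|N| = \sum_(k < n) `|M| * `|N|.
  by rewrite sumr_const card_ord -mulrA mulr_natl.
by apply: ler_sum => k _; rewrite normrM ler_pM// normr_entry_le.
Qed.

Lemma absolutely_continuous_mulmxl (R : realType) (n p : nat)
    (C : 'M[R]_(p, n)) (a b : R) (x : R -> 'cV[R]_n) :
  absolutely_continuous a b x ->
  absolutely_continuous a b (fun t => C *m x t).
Proof.
move=> acx; apply: (absolutely_continuous_dominated (K := n%:R * `|C|) acx).
  by rewrite mulr_ge0.
move=> s t _ st _; rewrite -mulmxBr; apply: le_trans (normr_mulmx_le _ _) _.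
by rewrite ler_wpM2l ?mulr_ge0// lerDl subr_ge0.
Qed.

(** The composite is continuous on a compact segment. Applied to [A] along the plant output, it
    gives the growth constant for positivity. *)
Lemma bounded_along_ac (R : realType) (V W : normedModType R) (f : V -> W)
    (a b : R) (y : R -> V) :
  locally_lipschitz f -> absolutely_continuous a b y ->
  exists K, forall t, a <= t <= b -> `|f (y t)| <= K.
Proof.
move=> /locally_lipschitz_continuous cf acy.
have cfy : {within `[a, b], continuous (f \o y)}.
  apply/subspace_continuousP => t; rewrite /= in_itv/= => tab.
  suff cy : y s @[s --> within `[a, b]%classic (nbhs t)] --> y t.
    exact: cvg_comp cy (cf (y t)).
  apply/cvgrPdist_lt => e e0; have [r r0 yr] := ac_continuous_at acy tab e0.
  have tr : \forall s \near t, `|t - s| < r by exact: nbhsx_ballx.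
  rewrite near_withinE; apply: filterS tr => s tsr; rewrite /= in_itv/= => sab.
  by rewrite distrC; apply: yr => //; rewrite distrC.
have [m [_ /(_ (m + 1))]] :=
  compact_bounded (continuous_compact cfy (@segment_compact _ a b)).
rewrite ltrDl ltr01 => /(_ isT) fm; exists (m + 1) => t tab.
by apply: fm; exists t => //; rewrite /= in_itv.
Qed.

Lemma bigmin_attained (R : realType) (m : nat) (F : 'I_m.+1 -> R) :
  (exists k, \big[Num.min/F ord0]_k F k = F k) /\
  forall k, \big[Num.min/F ord0]_k F k <= F k.
Proof.
split; last by move=> k; exact: bigmin_le_cond.
(* The default value [F ord0] is itself a member, so being a value of [F] survives the whole
   iteration. *)
apply: (big_ind (fun x => exists k, x = F k)) => [|x y [k ->] [l ->]|k _];
  [by exists ord0| |by exists k].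
by rewrite minEle; case: ifP; [exists k | exists l].
Qed.

Lemma bigmax_attained (R : realType) (m : nat) (F : 'I_m.+1 -> R) :
  (exists k, \big[Num.max/F ord0]_k F k = F k) /\
  forall k, F k <= \big[Num.max/F ord0]_k F k.
Proof.
split; last by move=> k; exact: le_bigmax.
apply: (big_ind (fun x => exists k, x = F k)) => [|x y [k ->] [l ->]|k _];
  [by exists ord0| |by exists k].
by rewrite maxEle; case: ifP; [exists l | exists k].
Qed.

(** * From the plant and observer to the error dynamics *)

Section ObserverError.
Context {R : realType} (n p q phi : nat) (C : 'M[R]_(p, n)).
Context (A : 'cV[R]_p -> 'M[R]_n) (beta : 'cV[R]_p * 'cV[R]_q -> 'cV[R]_n).
Context (u : R -> 'cV[R]_q) (delta d : R -> 'cV[R]_n).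
Context (L : 'I_phi.+1 -> 'M[R]_(n, p)) (T : \bar R) (x z : R -> 'cV[R]_n).
Hypothesis hx : caratheodory_sol (plant_rhs A beta C u delta) T x.

Let M k t := A (C *m x t) + L k *m C.

(** The [beta] terms cancel in the difference, and each candidate correction [L_k]_i (C z - C x) is
    row i of L_k C applied to the error. *)
Lemma upper_observer_error :
  caratheodory_sol
    (observer_rhs A beta (Qmin C L) (fun t => C *m x t) u d) T z ->
  error_solution M (fun t => d t - delta t) T (z \- x).
Proof.
move=> [acz dz]; have [acx dx] := hx; split.
  by move=> b b0 bT; apply: absolutely_continuousB; [exact: acz|exact: acx].
apply: filterS2 dz dx; first exact: (ae_filter_ringOfSetsType lebesgue_measure).
move=> t dz dx t0 tT; have dzt := dz t0 tT; have dxt := dx t0 tT.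
eexists; first exact: is_deriveB.
move=> i.
pose F k := (row i (L k) *m (C *m z t - C *m x t)) 0 0.
set w := _ - plant_rhs _ _ _ _ _ _ _.
have wE : w i 0 = (A (C *m x t) *m (z t - x t)) i 0 +
    \big[Num.min/F ord0]_k F k + (d t - delta t) i 0.
  have sumE (X Y Q B D E : 'cV[R]_n) :
      (X + Q + B + D - (Y + B + E)) i 0 = (X - Y) i 0 + Q i 0 + (D - E) i 0.
    by rewrite !mxE; ring.
  by rewrite /w /observer_rhs /plant_rhs sumE -mulmxBr;
    congr (_ + _ + _); rewrite mxE.
have FE k : (M k t *m (z t - x t)) i 0 =
    (A (C *m x t) *m (z t - x t)) i 0 + F k.
  by rewrite /F -mulmxBr -row_mul mulmxA mulmxDl !mxE.
rewrite /= wE; have [[k Fk] Fmin] := bigmin_attained F; split.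
  by exists k; rewrite FE Fk.
by move=> l; rewrite FE lerD2r lerD2l.
Qed.

(** The error is taken with the opposite sign, which turns the maximum of the corrections into a
    minimum of their negatives. *)
Lemma lower_observer_error :
  caratheodory_sol
    (observer_rhs A beta (Qmax C L) (fun t => C *m x t) u d) T z ->
  error_solution M (fun t => delta t - d t) T (x \- z).
Proof.
move=> [acz dz]; have [acx dx] := hx; split.
  by move=> b b0 bT; apply: absolutely_continuousB; [exact: acx|exact: acz].
apply: filterS2 dz dx; first exact: (ae_filter_ringOfSetsType lebesgue_measure).
move=> t dz dx t0 tT; have dzt := dz t0 tT; have dxt := dx t0 tT.
eexists; first exact: is_deriveB.
move=> i.
pose F k := (row i (L k) *m (C *m z t - C *m x t)) 0 0.
set w := plant_rhs _ _ _ _ _ _ _ - _.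
have wE : w i 0 = (A (C *m x t) *m (x t - z t)) i 0 -
    \big[Num.max/F ord0]_k F k + (delta t - d t) i 0.
  have sumE (X Y Q B D E : 'cV[R]_n) :
      (Y + B + E - (X + Q + B + D)) i 0 = (Y - X) i 0 - Q i 0 + (E - D) i 0.
    by rewrite !mxE; ring.
  by rewrite /w /observer_rhs /plant_rhs sumE -mulmxBr;
    congr (_ - _ + _); rewrite mxE.
have FE k : (M k t *m (x t - z t)) i 0 =
    (A (C *m x t) *m (x t - z t)) i 0 - F k.
  rewrite /F -mulmxBr -row_mul mulmxA mulmxDl -(opprB (x t)) mulmxN !mxE.
  by rewrite opprK.
rewrite /= wE; have [[k Fk] Fmax] := bigmax_attained F; split.
  by exists k; rewrite FE Fk.
by move=> l; rewrite FE lerD2r lerD2l lerN2.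
Qed.

Lemma observer_matrix_bounded (b : R) :
  locally_lipschitz A -> 0 <= b -> (b%:E < T)%E ->
  exists K : R, forall k t i, 0 <= t <= b ->
    (M k t *m const_mx 1 : 'cV_n) i 0 <= K.
Proof.
move=> lA b0 bT; have [acx _] := hx.
have [K AK] := bounded_along_ac lA
  (absolutely_continuous_mulmxl C (acx b b0 bT)).
(* Summing over all gains makes the bound uniform in [k]. *)
exists (n%:R * (K + \sum_k `|L k *m C|) * `|const_mx 1 : 'cV[R]_n|) => k t i t0b.
apply: le_trans (ler_norm _) (le_trans (normr_entry_le _ _ _) _).
apply: le_trans (normr_mulmx_le _ _) _.
rewrite ler_wpM2r// ler_wpM2l//; apply: le_trans (ler_normD _ _) _.
rewrite lerD ?AK// (bigD1 k)//= lerDl.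
by apply: sumr_ge0.
Qed.

End ObserverError.

(** * Upper limits at infinity *)

Lemma lebesgue_ae_itv_nonempty (R : realType) (P : R -> Prop) (a b : R) :
  {ae lebesgue_measure, forall t, P t} -> a < b -> exists2 t, a < t < b & P t.
Proof.
move=> [D [mD D0 PD]] ab; apply: contrapT => noP.
have abD : `]a, b[ `<=` D.
  move=> t; rewrite /= in_itv/= => tab; apply: PD => Pt.
  by apply: noP; exists t.
have : (lebesgue_measure `]a, b[%classic <= lebesgue_measure D)%E.
  by apply: le_measure; rewrite ?inE.
rewrite [leRHS]D0 lebesgue_measure_itv/= lte_fin ab.
by rewrite -EFinB lee_fin subr_le0 leNgt ab.
Qed.

Lemma limsup_max_le (R : realType) (n : nat) (g : R -> 'I_n -> R) (c : R) :
  (\forall t \near +oo, forall i, g t i <= c) -> (limsup_max g <= c%:E)%E.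
Proof.
move=> gc; rewrite /limsup_max limf_esupE.
apply: le_trans (ereal_inf_lbound _) _.
  by exists [set t | forall i, g t i <= c]; [exact: gc|].
apply: ge_ereal_sup => _ [t gt <-].
by apply: bigmax_le => [|i _]; [exact: leNye | rewrite lee_fin; exact: gt].
Qed.

Lemma limsup_max_lt (R : realType) (n : nat) (g : R -> 'I_n -> R) (c : R) :
  (limsup_max g < c%:E)%E -> \forall t \near +oo, forall i, g t i <= c.
Proof.
rewrite /limsup_max limf_esupE => /ereal_inf_lt[_ [U Uoo <-]] /ltW Uc.
apply: filterS Uoo => t Ut i; rewrite -lee_fin; apply: le_trans Uc.
apply: le_trans (ereal_sup_ubound _); last by exists t.
exact: (le_bigmax _ (fun i => (g t i)%:E)).
Qed.

(** Every neighbourhood of infinity contains an interval of positive length, hence a point where the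
    almost-everywhere bound holds; [0 < n] supplies an index to evaluate. *)
Lemma limsup_max_ge0 (R : realType) (n : nat) (g : R -> 'I_n -> R) :
  (0 < n)%N ->
  {ae lebesgue_measure, forall t, 0 <= t -> forall i, 0 <= g t i} ->
  (0 <= limsup_max g)%E.
Proof.
case: n g => // n g _ g0; rewrite /limsup_max limf_esupE.
apply: le_ereal_inf_tmp => _ [U [m [_ mU]] <-].
have mm : Num.max m 0 < Num.max m 0 + 1 by rewrite ltrDl.
have [t /andP[+ _] gt] := lebesgue_ae_itv_nonempty g0 mm.
rewrite gt_max => /andP[/mU Ut t0].
apply: le_trans (ereal_sup_ubound _); last by exists t.
apply: le_trans (le_bigmax _ (fun i => (g t i)%:E) ord0).
by rewrite lee_fin; apply: gt; exact: ltW.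
Qed.

Lemma limsup_max_gain (R : realType) (n : nat) (g w : R -> 'I_n -> R)
    (eps : R) :
  (0 < n)%N -> 0 < eps ->
  {ae lebesgue_measure, forall t, 0 <= t -> forall i, 0 <= w t i} ->
  (forall c, 0 <= c -> (\forall t \near +oo, forall i, w t i <= c) ->
     forall eta, 0 < eta ->
     \forall t \near +oo, forall i, g t i <= c / eps + eta) ->
  (limsup_max g <= (n%:R / eps)%:E * limsup_max w)%E.
Proof.
move=> n0 eps0 /(limsup_max_ge0 n0) w0 gw.
have neps0 : 0 < n%:R / eps by rewrite divr_gt0// ltr0n.
(* An infinite upper limit makes the right side infinite, because the gain is positive. *)
move: w0; case wl : (limsup_max w) => [l| |//] l0; last first.
  by rewrite gt0_muley ?leey// lte_fin.
apply/lee_addgt0Pr => e e0; rewrite -EFinM -EFinD; rewrite lee_fin in l0.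
have e20 : 0 < e / 2 by lra.
have ee0 : 0 < eps * (e / 2) by exact: mulr_gt0.
(* Taking [c = l + eps * (e / 2)] and [eta = e / 2] yields [l / eps + e]; the factor [n] enters only
   through [1 <= n] and [l >= 0]. *)
have gle : (limsup_max g <= ((l + eps * (e / 2)) / eps + e / 2)%:E)%E.
  apply: limsup_max_le; apply: gw => //; first lra.
  by apply: limsup_max_lt; rewrite wl lte_fin ltrDl.
apply: le_trans gle _; rewrite lee_fin.
have -> : (l + eps * (e / 2)) / eps + e / 2 = l / eps + e.
  by field; rewrite gt_eqF.
rewrite lerD2r mulrAC ler_pM2r ?invr_gt0// ler_peMl// -[1]/(1%:R).
by rewrite ler_nat.
Qed.

(** * Asymptotics of the error and the observer theorem *)

Lemma enormN (R : realType) (n : nat) (v : 'cV[R]_n) : enorm (- v) = enorm v.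
Proof.
by rewrite /enorm; congr Num.sqrt; apply: eq_bigr => i _; rewrite mxE sqrrN.
Qed.

Lemma enorm_le (R : realType) (n : nat) (v : 'cV[R]_n) (r : R) :
  0 <= r -> (forall i, `|v i 0| <= r) -> enorm v <= n%:R * r.
Proof.
move=> r0 vr; have nr0 : 0 <= n%:R * r by rewrite mulr_ge0.
rewrite /enorm -[leRHS]ger0_norm// -sqrtr_sqr ler_wsqrtr//.
apply: (@le_trans _ _ (\sum_(i < n) r ^+ 2)).
  apply: ler_sum => i _.
  by rewrite -[v i 0 ^+ 2]real_normK ?num_real// lerXn2r// nnegrE.
rewrite sumr_const card_ord exprMn -[leLHS]mulr_natl ler_wpM2r ?sqr_ge0//.
by rewrite -natrX ler_nat; case: n {v vr nr0} => // n; exact: leq_pmulr.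
Qed.

Lemma error_solution_cvg0 (R : realType) (n phi : nat)
    (M : 'I_phi.+1 -> R -> 'M[R]_n) (w : R -> 'cV[R]_n) (e : R -> 'cV[R]_n)
    (l : 'I_phi.+1) (v : 'cV[R]_n) (eps : R) :
  error_solution M w +oo%E e -> (forall t, metzler (M l t)) ->
  (forall t : R, 0 <= t -> cvec_le 0 (e t)) ->
  cvec_ll 0 v -> 0 < eps -> (forall i t, (M l t *m v) i 0 <= - eps * v i 0) ->
  (forall t : R, 0 < t -> w t = 0) ->
  enorm (e t) @[t --> +oo] --> 0.
Proof.
move=> se hM e0 v0 eps0 Mv w0; apply/cvgrPdist_lt => r r0.
(* The added 1 makes [K] positive and the final bound strictly below [r]. *)
pose K := n%:R * `|v| + 1.
have K0 : 0 < K by rewrite ltr_pwDr// mulr_ge0.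
have rK0 : 0 < r / K by exact: divr_gt0.
have wc t : 0 < t -> forall i, w t i 0 <= 0 * v i 0.
  by move=> /w0 -> i; rewrite mxE mul0r.
have decay := error_solution_decay se hM e0 v0 eps0 Mv (lexx 0) (lexx 0) wc rK0.
near=> t.
have t0 : 0 <= t by near: t; apply: nbhs_pinfty_ge; exact: num_real.
have et : forall i, e t i 0 / v i 0 <= 0 / eps + r / K by near: t.
rewrite sub0r normrN ger0_norm ?sqrtr_ge0//.
apply: le_lt_trans (enorm_le (r := r / K * `|v|) _ _) _ => [|i|].
- by rewrite mulr_ge0// ltW.
- have vi0 : 0 < v i 0 by have := v0 i; rewrite mxE.
  have ei0 : 0 <= e t i 0 by have := e0 t t0 i; rewrite mxE.
  rewrite ger0_norm//; have := et i; rewrite mul0r add0r ler_pdivrMr//.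
  move=> /le_trans; apply; rewrite ler_wpM2l ?(ltW rK0)//.
  exact: le_trans (ler_norm _) (normr_entry_le _ _ _).
- by rewrite mulrCA mulrAC ltr_pdivrMr// ltr_pM2l// ltrDl.
Unshelve. all: by end_near. Qed.

Lemma error_solution_limsup (R : realType) (n phi : nat)
    (M : 'I_phi.+1 -> R -> 'M[R]_n) (w : R -> 'cV[R]_n) (e : R -> 'cV[R]_n)
    (l : 'I_phi.+1) (v : 'cV[R]_n) (eps : R) :
  (0 < n)%N ->
  error_solution M w +oo%E e -> (forall t, metzler (M l t)) ->
  (forall t : R, 0 <= t -> cvec_le 0 (e t)) ->
  cvec_ll 0 v -> 0 < eps -> (forall i t, (M l t *m v) i 0 <= - eps * v i 0) ->
  {ae lebesgue_measure, forall t : R, 0 <= t -> cvec_le 0 (w t)} ->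
  (limsup_max (fun t i => (v i 0)^-1 * e t i 0)%R <=
   (n%:R / eps)%:E * limsup_max (fun t i => w t i 0 / v i 0)%R)%E.
Proof.
move=> n0 se hM e0 v0 eps0 Mv w0.
have vi0 i : 0 < v i 0 by have := v0 i; rewrite mxE.
apply: limsup_max_gain => //.
  apply: filterS w0; first exact: (ae_filter_ringOfSetsType lebesgue_measure).
  move=> t wt t0 i; rewrite divr_ge0 ?(ltW (vi0 i))//.
  by have := wt t0 i; rewrite mxE.
move=> c c0 [m [_ mc]] eta eta0.
(* The decay estimate starts at a nonnegative time after which the bound [c] is in force. *)
have am0 : 0 <= Num.max m 0 by rewrite le_max lexx orbT.
have wc t : Num.max m 0 < t -> forall i, w t i 0 <= c * v i 0.
  by rewrite gt_max => /andP[/mc wt _] i; rewrite -ler_pdivrMr.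
have := error_solution_decay se hM e0 v0 eps0 Mv c0 am0 wc eta0.
by apply: filterS => t et i; rewrite mulrC.
Qed.

Theorem theorem1 (R : realType) (n p q phi : nat) (hn : (0 < n)%N)
  (C : 'M[R]_(p, n))
  (A : 'cV[R]_p -> 'M[R]_n) (hA : locally_lipschitz A)
  (beta : 'cV[R]_p * 'cV[R]_q -> 'cV[R]_n) (hbeta : locally_lipschitz beta)
  (dbar dund : R -> 'cV[R]_n)
  (hdbar : piecewise_continuous dbar) (hdund : piecewise_continuous dund)
  (Lbar Lund : 'I_phi.+1 -> 'M[R]_(n, p))
  (hMbar : forall k w, metzler (A w + Lbar k *m C))
  (hMund : forall k w, metzler (A w + Lund k *m C))
  (lbar lund : 'I_phi.+1) (vbar vund : 'cV[R]_n) (ebar eund : R)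
  (hvbar : cvec_ll 0 vbar) (hvund : cvec_ll 0 vund)
  (hebar : 0 < ebar) (heund : 0 < eund)
  (hbar : forall i w,
    (row i (A w + Lbar lbar *m C) *m vbar) 0 0 <= - ebar * vbar i 0)
  (hund : forall i w,
    (row i (A w + Lund lund *m C) *m vund) 0 0 <= - eund * vund i 0)
  (u : R -> 'cV[R]_q) (hu : piecewise_continuous u)
  (x0 : 'cV[R]_n) (delta : R -> 'cV[R]_n)
  (T : \bar R) (x xbar xund : R -> 'cV[R]_n)
  (hx : maximal_sol (plant_rhs A beta C u delta) x0 T x)
  (hxbar : caratheodory_sol
    (observer_rhs A beta (Qmin C Lbar) (fun t => C *m x t) u dbar) T xbar)
  (hxund : caratheodory_sol
    (observer_rhs A beta (Qmax C Lund) (fun t => C *m x t) u dund) T xund)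
  (hx0und : cvec_le (xund 0) x0) (hx0bar : cvec_le x0 (xbar 0)) :
  [/\ (* (i) *)
      (forall t, 0 <= t -> [/\ delta t = 0, dbar t = 0 & dund t = 0]) ->
      T = +oo%E ->
      enorm (xbar t - x t) @[t --> +oo] --> 0 /\
      enorm (xund t - x t) @[t --> +oo] --> 0,
      (* (ii) *)
      disturbance delta ->
      {ae lebesgue_measure, forall t : R, 0 <= t ->
         cvec_le (dund t) (delta t) /\ cvec_le (delta t) (dbar t)} ->
      forall t : R, 0 <= t -> (t%:E < T)%E ->
        cvec_le (xund t) (x t) /\ cvec_le (x t) (xbar t)
    & (* (iii) *)
      disturbance delta ->
      {ae lebesgue_measure, forall t : R, 0 <= t ->
         cvec_le (dund t) (delta t) /\ cvec_le (delta t) (dbar t)} ->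
      T = +oo%E ->
      (limsup_max (fun t i => (vbar i 0)^-1 * (xbar t i 0 - x t i 0))%R <=
       (n%:R / ebar)%:E *
       limsup_max (fun t i => (dbar t i 0 - delta t i 0) / vbar i 0)%R)%E /\
      (limsup_max (fun t i => (vund i 0)^-1 * (x t i 0 - xund t i 0))%R <=
       (n%:R / eund)%:E *
       limsup_max (fun t i => (delta t i 0 - dund t i 0) / vund i 0)%R)%E].
Proof.
have [_ x00 solx _] := hx.
have eu := upper_observer_error solx hxbar.
have el := lower_observer_error solx hxund.
(* Positivity of both errors is established on the whole existence interval; it is part (ii), and
   with [T = +oo] it feeds the decay in (i) and (iii). *)
have eu_ge0 : {ae lebesgue_measure, forall t : R, 0 < t -> (t%:E < T)%E ->
      cvec_le 0 (dbar t - delta t)} ->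
    forall t, 0 <= t -> (t%:E < T)%E -> cvec_le 0 (xbar t - x t).
  move=> w0; apply: (error_solution_ge0 eu) => [k t|b b0 bT||i].
  - exact: hMbar.
  - exact: (observer_matrix_bounded Lbar solx hA b0 bT).
  - exact: w0.
  - by rewrite !mxE subr_ge0 x00.
have el_ge0 : {ae lebesgue_measure, forall t : R, 0 < t -> (t%:E < T)%E ->
      cvec_le 0 (delta t - dund t)} ->
    forall t, 0 <= t -> (t%:E < T)%E -> cvec_le 0 (x t - xund t).
  move=> w0; apply: (error_solution_ge0 el) => [k t|b b0 bT||i].
  - exact: hMund.
  - exact: (observer_matrix_bounded Lund solx hA b0 bT).
  - exact: w0.
  - by rewrite !mxE subr_ge0 x00.
have Mbar i t : ((A (C *m x t) + Lbar lbar *m C) *m vbar) i 0 <=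
    - ebar * vbar i 0.
  by have := hbar i (C *m x t); rewrite -row_mul mxE.
have Mund i t : ((A (C *m x t) + Lund lund *m C) *m vund) i 0 <=
    - eund * vund i 0.
  by have := hund i (C *m x t); rewrite -row_mul mxE.
have wbound : {ae lebesgue_measure, forall t : R, 0 <= t ->
      cvec_le (dund t) (delta t) /\ cvec_le (delta t) (dbar t)} ->
    {ae lebesgue_measure, forall t : R, 0 <= t ->
      cvec_le 0 (dbar t - delta t)} /\
    {ae lebesgue_measure, forall t : R, 0 <= t ->
      cvec_le 0 (delta t - dund t)}.
  move=> bd; split; apply: filterS bd;
    try exact: (ae_filter_ringOfSetsType lebesgue_measure).
  - by move=> t bt t0 i; rewrite !mxE subr_ge0; have [] := bt t0.
  - by move=> t bt t0 i; rewrite !mxE subr_ge0; have [] := bt t0.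
have weaken (w : R -> 'cV[R]_n) :
    {ae lebesgue_measure, forall t : R, 0 <= t -> cvec_le 0 (w t)} ->
    {ae lebesgue_measure, forall t : R, 0 < t -> (t%:E < T)%E ->
      cvec_le 0 (w t)}.
  apply: filterS; first exact: (ae_filter_ringOfSetsType lebesgue_measure).
  by move=> t wt t0 _; apply: wt; exact: ltW.
have zero_ae (w : R -> 'cV[R]_n) : (forall t, 0 <= t -> w t = 0) ->
    {ae lebesgue_measure, forall t : R, 0 <= t -> cvec_le 0 (w t)}.
  by move=> w0; apply: aeW => t /= /w0 -> i.
split.
- move=> d0 TE.
  have wu t : 0 <= t -> dbar t - delta t = 0.
    by move=> /d0[-> -> _]; rewrite subrr.
  have wl t : 0 <= t -> delta t - dund t = 0.
    by move=> /d0[-> _ ->]; rewrite subrr.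
  have eu0 := eu_ge0 (weaken _ (zero_ae _ wu)).
  have el0 := el_ge0 (weaken _ (zero_ae _ wl)).
  move: eu el eu0 el0; rewrite TE => eu el eu0 el0; split.
  + apply: (error_solution_cvg0 eu _ _ hvbar hebar Mbar) => [t|t t0|t /ltW/wu//].
      exact: hMbar.
    by apply: eu0 => //; exact: ltry.
  + under eq_fun do rewrite -opprB enormN.
    apply: (error_solution_cvg0 el _ _ hvund heund Mund) => [t|t t0|t /ltW/wl//].
      exact: hMund.
    by apply: el0 => //; exact: ltry.
- move=> _ /wbound[/weaken/eu_ge0 eu0 /weaken/el_ge0 el0] t t0 tT.
  split=> i; rewrite -subr_ge0.
  + by have := el0 t t0 tT i; rewrite !mxE.
  + by have := eu0 t t0 tT i; rewrite !mxE.
- move=> _ /wbound[bu bl] TE.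
  have eu0 := eu_ge0 (weaken _ bu); have el0 := el_ge0 (weaken _ bl).
  move: eu el eu0 el0; rewrite TE => eu el eu0 el0; split.
  + have := error_solution_limsup hn eu (fun t => hMbar lbar _)
      (fun t t0 => eu0 t t0 (ltry _)) hvbar hebar Mbar bu.
    rewrite /=; under eq_fun do under eq_fun do rewrite !mxE.
    by under [in X in (_ <= _ * X)%E]eq_fun do under eq_fun do rewrite !mxE.
  + have := error_solution_limsup hn el (fun t => hMund lund _)
      (fun t t0 => el0 t t0 (ltry _)) hvund heund Mund bl.
    rewrite /=; under eq_fun do under eq_fun do rewrite !mxE.
    by under [in X in (_ <= _ * X)%E]eq_fun do under eq_fun do rewrite !mxE.
Qed.
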